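(* Let $D$ be a pregear symmetric in $\mathbb{R}$, with no vertices on $\mathbb{R}$. Suppose that $D$ is not a gear. Let $p_{-1},p_1\in\partial D$ ($p_{-1}<p_1$) be the extreme points of the real interval $D\cap\mathbb{R}$ (i.e., the midpoints of the non-tooth edges of $D$). Let $\rho$ be the common radius of the tooth edges, and let $p\in\partial D$ be an interior point of either tooth edge. Let $v$ be the inward pointing unit normal to the tooth edge at $p$. Define $$c=p+\rho v,\qquad d=\left(\rho^2-(\mathrm{Im}\,c)^2\right)^{1/2},\qquad b^\pm=\mathrm{Re}\,c\pm d,$$ and $$T_{b^\pm}(z)=\begin{cases}-\dfrac{z-b^-}{z-b^+} & \text{if } p_{-1}<b^-<p_1,\\[2ex] \dfrac{z-b^+}{z-b^-} & \text{if } p_{-1}<b^+<p_1.\end{cases}$$ Then the image $G=T_{b^\pm}(D)$ is a gear with gear center at the origin. Its gear parameters are given by $$\beta=-\frac{T_{b^\pm}(p_1)}{T_{b^\pm}(p_{-1})},\qquad \gamma=\arg T_{b^\pm}(p).$$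
   Context: One-tooth gear domain (gear): a topological quadrilateral in the complex plane which is the union of an open disk and a sector of a concentric disk of larger radius. Up to an affine map $az+b$ it is the standard domain $G_{\beta,\gamma}$ (with $\beta>1$, $0<\gamma<\pi$) with vertices $w_1=\beta e^{i\gamma}$, $w_2=e^{i\gamma}$, $w_3=e^{-i\gamma}$, $w_4=\beta e^{-i\gamma}$, where the edges $[w_1,w_2]$ and $[w_3,w_4]$ are straight segments, called the tooth edges, and the other edges are the arcs of $\{|w|=1\}$ with $\gamma<\arg w<2\pi-\gamma$ and of $\{|w|=\beta\}$ with $-\gamma<\arg w<\gamma$. The gear parameters are the gear ratio $\beta$ and the gear angle $\gamma$; the gear center (tooth center) is the common center of the concentric circles containing the circular boundary arcs of the gear. A pregear is a Möbius transformation (image under a Möbius transformation) of a one-tooth gear domain; its vertices and tooth edges correspond to those of the gear, and the tooth edges are the edges having different interior angles ($\pi/2$ and $3\pi/2$) at their two endpoints. The radius of an edge is the radius of the full circle containing it.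
   Formalization: The formulas for β and γ are asserted only when p₁ lies on the outer-arc edge (otherwise −T(p₁)/T(p₋₁)=1/β<1); for p on the lower tooth edge γ=−arg T(p); ''inward'' normal means toward the center of the circle containing the tooth edge. *)

(* Defs.v *)
From HB Require Import structures.
From mathcomp Require Import all_boot all_order all_algebra.
From mathcomp Require Import all_classical all_reals all_analysis.
From mathcomp Require Import complex.
Set Implicit Arguments.
Unset Strict Implicit.
Unset Printing Implicit Defensive.
Import Order.TTheory GRing.Theory Num.Theory.
Import mathcomp.real_closed.complex.
Local Open Scope classical_set_scope.
Local Open Scope ring_scope.
Local Open Scope complex_scope.

(* On R[i] the norm `|z| is a complex number with zero imaginary part, and
   x < y means that y - x is real and positive; hence `|z| < r%:C compares
   moduli. *)

(* Principal argument, with values in ]-pi, pi]; irrelevant value at 0. *)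
Definition Arg (R : realType) (z : R[i]) : R :=
  let theta := acos (Re z / Re `|z|) in
  if 0 <= Im z then theta else - theta.

Definition expi (R : realType) (theta : R) : R[i] := cos theta +i* sin theta.

Definition segment (R : realType) (u v : R[i]) : set R[i] :=
  [set z | exists2 t : R, 0 <= t <= 1 & z = u + t%:C * (v - u)].

(* The origin, where Arg is meaningless, lies in the disk anyway. *)
Definition std_gear (R : realType) (beta gamma : R) : set R[i] :=
  [set w | `|w| < 1] `|` [set w | `|w| < beta%:C /\ `|Arg w| < gamma].

Definition gear_with (R : realType) (D : set R[i]) (center : R[i])
    (beta gamma : R) : Prop :=
  [/\ 1 < beta, 0 < gamma < pi
    & exists2 a : R[i], a != 0
        & D = [set a * w + center | w in std_gear beta gamma]].

Definition is_gear (R : realType) (D : set R[i]) : Prop :=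
  exists (center : R[i]) (beta gamma : R), gear_with D center beta gamma.

(* A pregear is presented as the image of the standard gear by
   w |-> (a w + b) / (c w + d). Composing with affine maps shows that standard
   gears suffice. The presentation fixes the vertices and edges. *)
Record pregear (R : realType) := Pregear {
  pg_a : R[i];
  pg_b : R[i];
  pg_c : R[i];
  pg_d : R[i];
  pg_ratio : R;
  pg_angle : R;
  pg_det : pg_a * pg_d - pg_b * pg_c != 0;
  pg_ratio_gt1 : 1 < pg_ratio;
  pg_angle_itv : 0 < pg_angle < pi
}.

(* Image of a set by the Moebius transformation, minus the point at infinity. *)
Definition pg_image (R : realType) (P : pregear R) (A : set R[i]) : set R[i] :=
  [set z | exists2 w, A w
     & pg_c P * w + pg_d P != 0 /\
       z = (pg_a P * w + pg_b P) / (pg_c P * w + pg_d P)].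

Section Quadrilateral.
Variables (R : realType) (P : pregear R).

Let w1 : R[i] := (pg_ratio P)%:C * expi (pg_angle P).
Let w2 : R[i] := expi (pg_angle P).
Let w3 : R[i] := expi (- pg_angle P).
Let w4 : R[i] := (pg_ratio P)%:C * expi (- pg_angle P).

Definition pg_domain : set R[i] :=
  pg_image P (std_gear (pg_ratio P) (pg_angle P)).

Definition pg_vertices : set R[i] :=
  pg_image P [set w | [\/ w = w1, w = w2, w = w3 | w = w4]].

Definition is_tooth_edge (E : set R[i]) : Prop :=
  E = pg_image P (segment w1 w2) \/ E = pg_image P (segment w3 w4).

(* The non-tooth edge between the images of w4 and w1. *)
Definition pg_outer_edge : set R[i] :=
  pg_image P [set w | `|w| = (pg_ratio P)%:C /\ `|Arg w| <= pg_angle P].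

End Quadrilateral.

Definition edge_circle (R : realType) (E : set R[i]) (c0 : R[i]) (r : R) : Prop :=
  0 < r /\ E `<=` [set z | `|z - c0| = r%:C].

Definition dot (R : realType) (u v : R[i]) : R := Re (u * v^*).

(* "Inward" refers to the disk bounded by the circle containing the edge. The
   tangent to that circle at p has direction 'i * (p - c0). *)
Definition inward_unit_normal (R : realType) (E : set R[i]) (p v : R[i]) : Prop :=
  exists (c0 : R[i]) (r : R),
    [/\ edge_circle E c0 r, `|v| = 1, dot v ('i * (p - c0)) = 0
      & 0 < dot v (c0 - p)].

(* The last branch is a dummy: T is only meaningful if one of bm, bp lies in
   ]pm, pp[. *)
Definition T_map (R : realType) (pm pp bm bp : R) (z : R[i]) : R[i] :=
  if pm < bm < pp then - ((z - bm%:C) / (z - bp%:C))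
  else if pm < bp < pp then (z - bp%:C) / (z - bm%:C)
  else 0.

(* Main.v *)
Require Import Defs.
From HB Require Import structures.
From mathcomp Require Import all_boot all_order all_algebra.
From mathcomp Require Import all_classical all_reals all_analysis.
From mathcomp Require Import complex.
From mathcomp Require Import ring lra.
Set Implicit Arguments.
Unset Strict Implicit.
Unset Printing Implicit Defensive.
Import Order.TTheory GRing.Theory Num.Theory.
Import mathcomp.real_closed.complex.
Import numFieldNormedType.Exports.
Local Open Scope classical_set_scope.
Local Open Scope ring_scope.
Local Open Scope complex_scope.

(** Write the standard gear as [G] and the pregear as [D = M(G)] with
    [M(w) = a + k / (w - q)]; the case of an affine [M] is the excluded one,
    since then [D] is a gear. The real trace of [D] is bounded and [G] is open,
    so the pole [q] is not in [G].

    The heart of the matter is that [a], [k] and [q] are real, that is, that [M]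
    commutes with complex conjugation. The symmetry of [D] says that the
    anti-Moebius involution [tau = M^-1 o conj o M], of the form
    [w |-> (A conj(w) + iB) / (iC conj(w) + conj(A))] with [B] and [C] real,
    maps [G] into itself, hence maps boundary points of [G] to boundary points.
    The boundary of [G] lies on four generalized circles: [|w| = 1],
    [|w| = beta] and the two lines that carry the tooth edges. Along an arc of
    the circle [|w| = r] of the boundary, with [r = 1] or [r = beta], the
    product of the equations of these four curves, pulled back by [tau] and
    rationally parametrized by [t], is a polynomial with infinitely many roots;
    so one of its factors vanishes identically ([arc_image]). If that factor
    comes from a circle then [B = - r^2 C], if it comes from a line then
    [B = r^2 C]. These conditions for [r = 1] and for [r = beta] force
    [B = C = 0] ([tau_linear]). Now [tau] is a reflection in a line through the
    origin, and looking at the end points of the tooth one finds that it is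
    complex conjugation ([tau_conj]).

    For real [a], [k], [q] the rest is a computation. The end points of the real
    trace of [D] are [M(-1)] and [M(beta)] ([real_trace]); the point
    [m = M(0) = a - k / q] lies between them, and [a = M(oo)] lies outside. The
    lines that carry the tooth edges of [G] pass through [0] and [oo], so the
    circle that carries [E] passes through [m] and [a] ([tooth_circle]). Its
    center is the point [c] of the theorem, whence [{b-, b+} = {a, m}]. Thus
    [T o M] is a Moebius map that fixes [0] and [oo], in fact
    [T(M(w)) = kappa * w] with [kappa = 1/q] or [kappa = -1/q]
    ([T_map_pointed]), and the image of [D] is [kappa * G]. When the right end
    point of the trace is [M(beta)], one has [k < 0] and [kappa > 0], and the
    formulas for the gear parameters can be read off. *)

(** * The modulus as a real number *)

(** The modulus of a complex number; the norm of [R[i]] itself takes its values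
    in [R[i]]. *)
Definition cabs (R : realType) (z : R[i]) : R := Re `|z|.
Arguments cabs : simpl never.

Section Modulus.
Variable R : realType.
Implicit Types z w : R[i].

Lemma cabsE z : cabs z = Num.sqrt (Re z ^+ 2 + Im z ^+ 2).
Proof. by rewrite /cabs normc_def. Qed.

Lemma normC_cabs z : `|z| = (cabs z)%:C.
Proof. by rewrite /cabs normc_def. Qed.

Lemma cabsN z : cabs (- z) = cabs z.
Proof. by rewrite /cabs normrN. Qed.

Lemma cabs0 : cabs 0 = 0 :> R.
Proof. by rewrite /cabs normr0. Qed.

Lemma cabs_distC z w : cabs (z - w) = cabs (w - z).
Proof. by rewrite -cabsN opprB. Qed.

Lemma cabs_ge0 z : 0 <= cabs z.
Proof. by rewrite cabsE sqrtr_ge0. Qed.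

Lemma cabs_sqr z : (cabs z) ^+ 2 = Re z ^+ 2 + Im z ^+ 2.
Proof. by rewrite cabsE sqr_sqrtr // addr_ge0 ?sqr_ge0. Qed.

Lemma cabsM z w : cabs (z * w) = cabs z * cabs w.
Proof. by rewrite {1}/cabs normrM !normC_cabs -rmorphM. Qed.

Lemma cabsC (x : R) : cabs (x%:C) = `|x|.
Proof. by rewrite cabsE /= expr0n addr0 sqrtr_sqr. Qed.

Lemma cabs_eq0 z : cabs z = 0 -> z = 0.
Proof. by move=> h; apply/eqP; rewrite -normr_eq0 normC_cabs h. Qed.

Lemma cabsD z w : cabs (z + w) <= cabs z + cabs w.
Proof. by have := ler_normD z w; rewrite !normC_cabs -rmorphD lecR. Qed.

Lemma cabs_conj z : cabs (conjc z) = cabs z.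
Proof. by rewrite /cabs normcJ. Qed.

Lemma Re_le_cabs z : `|Re z| <= cabs z.
Proof.
by rewrite cabsE -sqrtr_sqr ler_wsqrtr // lerDl sqr_ge0.
Qed.

Lemma Re_le z : Re z <= cabs z.
Proof. exact: le_trans (ler_norm _) (Re_le_cabs z). Qed.

Lemma ltc_cabs z (r : R) : (`|z| < r%:C) = (cabs z < r).
Proof. by rewrite normC_cabs ltcR. Qed.

Lemma eqc_cabs z (r : R) : (`|z| = r%:C) <-> (cabs z = r).
Proof. by rewrite normC_cabs; split=> [[]|->]. Qed.

Lemma cabs_eq_sqr z (r : R) : 0 <= r -> cabs z =
  r <-> Re z ^+ 2 + Im z ^+ 2 = r ^+ 2.
Proof.
move=> r0; rewrite -cabs_sqr; split=> [->//|/eqP].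
by rewrite eqrXn2 ?cabs_ge0 // => /eqP.
Qed.

End Modulus.

(** * The standard gear and its boundary *)

Section Gear.
Variables (R : realType) (beta gamma : R).
Hypothesis gamma_itv : 0 < gamma < pi.
Implicit Types z w : R[i].

Let gear := std_gear beta gamma.

Lemma sin_gamma_gt0 : 0 < sin gamma.
Proof. exact: sin_gt0_pi. Qed.

Lemma abs_cos_lt1 : `|cos gamma| < 1.
Proof.
have := cos2Dsin2 gamma; have := sin_gamma_gt0 => s0 h.
by rewrite ltNge; apply/negP; rewrite ler_normr; nra.
Qed.

Lemma Re_div_cabs_itv w : -1 <= Re w / cabs w <= 1.
Proof.
rewrite -ler_norml normf_div (ger0_norm (cabs_ge0 w)).
have [->|h] := eqVneq (cabs w) 0; first by rewrite invr0 mulr0.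
by rewrite ler_pdivrMr ?mul1r ?Re_le_cabs // lt_def h cabs_ge0.
Qed.

Lemma abs_ArgE w : `|Arg w| = acos (Re w / cabs w).
Proof.
rewrite /Arg; have h := acos_ge0 (Re_div_cabs_itv w).
by case: ifP => _; rewrite ?normrN ger0_norm.
Qed.

Lemma lt_abs_Arg w : w != 0 ->
  (`|Arg w| < gamma) = (cos gamma * cabs w < Re w).
Proof.
move=> w0; have m0 : 0 < cabs w.
  by rewrite lt_def cabs_ge0 andbT; apply: contra_neq w0; exact: cabs_eq0.
have h := Re_div_cabs_itv w; rewrite abs_ArgE -ltr_pdivlMr //.
have cacos : cos (acos (Re w / cabs w)) = Re w / cabs w.
  by rewrite acosK ?in_itv.
have g_itv : gamma \in `[0, pi].
  by rewrite in_itv /=; case/andP: gamma_itv => ? ?; rewrite !ltW.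
have a_itv : acos (Re w / cabs w) \in `[0, pi].
  by rewrite in_itv /= acos_ge0 ?acos_lepi.
by rewrite -[in RHS]cacos ltr_cos.
Qed.

(** The standard gear, described without arguments. *)
Lemma gearP w : gear w <->
  cabs w < 1 \/ cabs w < beta /\ cos gamma * cabs w < Re w.
Proof.
rewrite /gear /std_gear /setU /= -[X in _ < X]/(1%:C) !ltc_cabs.
have [->|w0] := eqVneq w 0.
  by split=> _; left; rewrite cabs0.
by rewrite lt_abs_Arg.
Qed.

Lemma cabs_dist w z : cabs z <= cabs w + cabs (z - w).
Proof. by rewrite -[X in cabs X](subrKC w) cabsD. Qed.

Lemma Re_dist w z : Re w <= Re z + cabs (z - w).
Proof.
by rewrite -lerBlDl -raddfB (le_trans (Re_le _)) // cabs_distC.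
Qed.

Lemma cos_cabs_dist w z :
  cos gamma * cabs z <= cos gamma * cabs w + cabs (z - w).
Proof.
rewrite -lerBlDl -mulrBr (le_trans (ler_norm _)) // normrM.
apply: le_trans (_ : `|cabs z - cabs w | <= _).
  by rewrite ler_piMl // ltW // abs_cos_lt1.
have := cabs_dist z w; rewrite cabs_distC => h1; have h2 := cabs_dist w z.
by rewrite ler_norml; apply/andP; split; lra.
Qed.

Lemma gear_open w : gear w ->
  exists2 e : R, 0 < e & forall z, cabs (z - w) < e -> gear z.
Proof.
move=> /gearP [m1|[mb cw]].
  exists (1 - cabs w); first by rewrite subr_gt0.
  by move=> z hz; apply/gearP; left; have := cabs_dist w z; lra.
exists (Num.min (beta - cabs w) ((Re w - cos gamma * cabs w) / 2)).
  by rewrite lt_min; apply/andP; split; lra.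
move=> z; rewrite lt_min => /andP[h1 h2]; apply/gearP; right.
split; first by have := cabs_dist w z; lra.
by have := Re_dist w z; have := cos_cabs_dist w z; lra.
Qed.

(** A boundary point of the gear lies on one of the two circles or on one of the
    two lines that carry its edges. *)
Lemma gear_adherent z : ~ gear z ->
    (forall e, 0 < e -> exists2 g, gear g & cabs (g - z) < e) ->
  [\/ cabs z = 1, cabs z = beta | Re z = cos gamma * cabs z].
Proof.
move=> ngz clz.
have n1 : 1 <= cabs z.
  by rewrite leNgt; apply/negP => h; apply: ngz; apply/gearP; left.
have [->|m1] := eqVneq (cabs z) 1; first by constructor 1.
have m1' : 0 < cabs z - 1 by rewrite subr_gt0 lt_def m1.
have [->|mb] := eqVneq (cabs z) beta; first by constructor 2.
have [->|mc] := eqVneq (Re z) (cos gamma * cabs z); first by constructor 3.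
have [e e0 he] : exists2 e : R, 0 < e &
    beta + e <= cabs z \/ Re z + e *+ 2 <= cos gamma * cabs z.
  have [hb|hb] := ltP beta (cabs z).
    by exists (cabs z - beta); [lra|left; lra].
  exists ((cos gamma * cabs z - Re z) / 2); last by right; lra.
  rewrite divr_gt0 // subr_gt0 lt_def eq_sym mc /= leNgt.
  by apply/negP => h; apply: ngz; apply/gearP; right; rewrite lt_def eq_sym mb.
have [|g /gearP gg] := clz (Num.min e (cabs z - 1)); first by rewrite lt_min e0.
rewrite lt_min => /andP[h1 h2].
have := cabs_dist g z; have := Re_dist g z; have := cos_cabs_dist g z.
rewrite -(cabs_distC g) => k1 k2 k3.
by case: gg => [|[? ?]]; case: he; lra.
Qed.

End Gear.

(** * Continuity of Moebius maps; polynomials vanishing near 0 *)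

Lemma homography_cvg (K : numFieldType) (F : set_system K) (FF : Filter F)
    (a b c d w : K) : c * w + d != 0 -> F --> w ->
  (a * z + b) / (c * z + d) @[z --> F] --> (a * w + b) / (c * w + d).
Proof.
move=> h Fw.
have aff (p q : K) : p * z + q @[z --> F] --> p * w + q.
  apply: cvgD; last exact: cvg_cst.
  by apply: cvgM => //; exact: cvg_cst.
by apply: cvgM; [exact: aff | apply: cvgV => //; exact: aff].
Qed.

Lemma homography_continuous (K : numFieldType) (a b c d w : K) :
  c * w + d != 0 -> forall e : K, 0 < e -> exists2 r : K, 0 < r &
    forall z, `|z - w| < r ->
      `|(a * z + b) / (c * z + d) - (a * w + b) / (c * w + d)| < e.
Proof.
move=> h e e0.
have /cvgr_dist_lt /(_ e e0) /nbhs_ballP[r /= r0 hr] :=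
  homography_cvg (nbhs_filter w) (a := a) (b := b) h cvg_id.
by exists r => // z; rewrite distrC => /hr /=; rewrite distrC.
Qed.

Section Moebius.
Variable R : realType.

Lemma moebius_continuous (a b c d w : R[i]) : c * w + d != 0 ->
  forall e : R, 0 < e -> exists2 r : R, 0 < r &
    forall z, cabs (z - w) < r ->
      cabs ((a * z + b) / (c * z + d) - (a * w + b) / (c * w + d)) < e.
Proof.
move=> h e e0; have eC : 0 < e%:C by rewrite ltcR.
have [r r0 hr] := homography_continuous a b h eC.
have [r1 r1E] : exists r1 : R, r = r1%:C.
  by exists (Re r); move: r0; rewrite ltcE;
    case: (r) => r1 r2 /= /andP[/eqP -> _].
exists r1; first by move: r0; rewrite r1E ltcR.
by move=> z hz; rewrite -ltc_cabs; apply: hr; rewrite r1E ltc_cabs.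
Qed.

Lemma poly_eq0_near0 (p : {poly R}) (e : R) : 0 < e ->
  (forall t, 0 < t < e -> p.[t] = 0) -> p = 0.
Proof.
move=> e0 h; apply/eqP; apply/negP => /negP p0.
pose f k : R := e / k.+2%:R.
have fI : injective f.
  move=> i j /(mulfI (lt0r_neq0 e0)) /invr_inj /eqP.
  by rewrite eqr_nat => /eqP [].
have := @max_poly_roots _ p (map f (iota 0 (size p))) p0.
rewrite size_map size_iota ltnn map_inj_uniq // iota_uniq => /(_ _ isT) H.
suff : false by []. apply: H.
apply/allP => _ /mapP[k _ ->]; rewrite rootE h // divr_gt0 //=.
by rewrite ltr_pdivrMr // ltr_pMr // ltr1n.
Qed.

End Moebius.

(** * Anti-Moebius involutions that preserve the gear *)

(** The map [tau w = num w / den w] is an anti-Moebius involution. It is handled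
    through the relation [w' * den w = num w], and it is assumed to map the gear
    into itself. *)
Section Reflection.
Variables (R : realType) (beta gamma : R).
Hypothesis beta_gt1 : 1 < beta.
Hypothesis gamma_itv : 0 < gamma < pi.
Let gear := std_gear beta gamma.

Variables x y B C : R.
Let A : R[i] := x +i* y.
Let num (w : R[i]) : R[i] := A * conjc w + (0 +i* B).
Let den (w : R[i]) : R[i] := (0 +i* C) * conjc w + conjc A.
Hypothesis det_gt0 : 0 < x ^+ 2 + y ^+ 2 + B * C.
Hypothesis tau_gear :
  forall w, gear w -> exists2 w', gear w' & w' * den w = num w.

(** Numerator and denominator have no common zero. *)
Lemma den_neq0 (w w' : R[i]) : w' * den w = num w -> den w != 0.
Proof.
move=> e; apply/negP => /eqP d0; move: e det_gt0; rewrite d0 mulr0 => /esym.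
move: d0; rewrite /den /num /A; case: w => u v.
move=> [d1 d2] [n1 n2].
have h1 : C * v + x = 0 by rewrite -d1; ring.
have h2 : C * u - y = 0 by rewrite -d2; ring.
have h3 : y * u - x * v + B = 0 by rewrite -n2; ring.
have -> : x ^+ 2 + y ^+ 2 + B * C =
    C * (y * u - x * v + B) - y * (C * u - y) + x * (C * v + x) by ring.
by rewrite h1 h2 h3 !mulr0 subr0 addr0 ltxx.
Qed.

Lemma tau_involutive (w z w' : R[i]) :
  z * den w = num w -> w' * den z = num z -> w' = w.
Proof.
move=> e1 e2; have d0 := den_neq0 e1.
have S0 : (x ^+ 2 + y ^+ 2 + B * C)%:C != 0.
  by rewrite (inj_eq (@complexI R)) lt0r_neq0.
apply: (mulIf S0).
have e1' : conjc z * conjc (den w) = conjc (num w) by rewrite -rmorphM e1.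
have -> : w * (x ^+ 2 + y ^+ 2 + B * C)%:C =
    A * conjc (num w) + (0 +i* B) * conjc (den w).
  rewrite /num /den /A; case: (w) => u v.
  by apply/eqP; rewrite eq_complex /=; apply/andP; split; apply/eqP; ring.
have -> : (x ^+ 2 + y ^+ 2 + B * C)%:C =
    (0 +i* C) * conjc (num w) + conjc A * conjc (den w).
  rewrite /num /den /A; case: (w) => u v.
  by apply/eqP; rewrite eq_complex /=; apply/andP; split; apply/eqP; ring.
rewrite -e1'; move: e2; rewrite {1}/den {1}/num => e2.
rewrite !mulrA -!mulrDl mulrA e2; ring.
Qed.

(** A point outside the gear that is the radial limit of points of the gear is
    mapped to a boundary point. *)
Lemma tau_boundary (w z : R[i]) : ~ gear w ->
    (forall e, 0 < e < 1 -> gear ((1 - e)%:C * w)) ->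
    z * den w = num w ->
  [\/ cabs z = 1, cabs z = beta | Re z = cos gamma * cabs z].
Proof.
move=> ngw gw e1; have d0 := den_neq0 e1.
apply: gear_adherent => //.
  by move=> gz; have [w' gw' /(tau_involutive e1) e2] := tau_gear gz;
    apply: ngw; rewrite -e2.
move=> e e0; have [r r0 hr] := moebius_continuous A (0 +i* B) d0 e0.
(* (1 - s) * w is in the gear, at distance s * |w| < r from w *)
pose s := Num.min (1 / 2) (r / (cabs w + 1)).
have w1 : 0 < cabs w + 1 by have := cabs_ge0 w; lra.
have s0 : 0 < s by rewrite lt_min divr_gt0 // divr_gt0.
have s1 : s < 1 by rewrite gt_min; apply/orP; left; lra.
have sr : s * (cabs w + 1) <= r by rewrite -ler_pdivlMr // ge_min lexx orbT.
have [g gg eg] := tau_gear (gw s (introT andP (conj s0 s1))).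
exists g => //.
have dg0 := den_neq0 eg.
have -> : g = num ((1 - s)%:C * w) / den ((1 - s)%:C * w) by rewrite -eg mulfK.
have -> : z = num w / den w by rewrite -e1 mulfK.
apply: hr; rewrite -rmorphB cabs_conj.
have -> : (1 - s)%:C * w - w = - s%:C * w by rewrite rmorphB rmorph1; ring.
rewrite cabsM cabsN cabsC gtr0_norm //; apply: lt_le_trans sr.
by rewrite ltr_pM2l // ltrDl.
Qed.

(** The point [s (1 + it) / (1 - it)], which describes the circle [|w| = |s|],
    minus [- s], when [t] ranges over [R]. *)
Definition circle_pt (s t : R) : R[i] :=
  (s * (1 - t ^+ 2) / (1 + t ^+ 2)) +i* (2 * s * t / (1 + t ^+ 2)).

(* n1 + i n2 and d1 + i d2 are the values of num and den at circle_pt s t,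
   multiplied by 1 + it to clear the denominators. *)
Let n1 s t := s * x + (s * y - B) * t.
Let n2 s t := s * y + B - s * x * t.
Let d1 s t := x + (y + C * s) * t.
Let d2 s t := C * s - y + x * t.
(* circ r s t = 0 when the image of circle_pt s t has modulus r, and
   line a s t = 0 when it is on the line through 0 and cos gamma + i a. *)
Let circ (r s t : R) := (n1 s t ^+ 2 + n2 s t ^+ 2)
  - r ^+ 2 * (d1 s t ^+ 2 + d2 s t ^+ 2).
Let line (a s t : R) := cos gamma * (n2 s t * d1 s t - n1 s t * d2 s t)
  - a * (n1 s t * d1 s t + n2 s t * d2 s t).

Lemma boundary_forms (s t : R) (w := circle_pt s t) : ~ gear w ->
    (forall e, 0 < e < 1 -> gear ((1 - e)%:C * w)) ->
  circ 1 s t * circ beta s t * (line (sin gamma) s t * line (- sin gamma) s t)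
    = 0.
Proof.
move=> ngw gw; have t1 : 1 + t ^+ 2 != 0
  by rewrite lt0r_neq0 // ltr_wpDr ?sqr_ge0.
have hu : Re w + t * Im w = s by rewrite /w /=; field.
have hv : Im w - t * Re w = s * t by rewrite /w /=; field.
have [d10 d20] : d1 s t = Re (den w) - t * Im (den w) /\
    d2 s t = Im (den w) + t * Re (den w).
  split; rewrite /d1 /d2 /den /A; move: hu hv; case: (w) => u v /= hu hv.
    transitivity (C * (s * t) + x + t * y); [ring|rewrite -hv /=; ring].
  transitivity (C * s - y + t * x); [ring|rewrite -hu /=; ring].
have [n10 n20] : n1 s t = Re (num w) - t * Im (num w) /\
    n2 s t = Im (num w) + t * Re (num w).
  split; rewrite /n1 /n2 /num /A; move: hu hv; case: (w) => u v /= hu hv.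
    transitivity (x * s + y * (s * t) - t * B); [ring|rewrite -hv -hu /=; ring].
  transitivity (y * s - x * (s * t) + B); [ring|rewrite -hv -hu /=; ring].
(* at the pole of tau both line forms vanish *)
have [dw0|dw0] := eqVneq (den w) 0.
  move: d10 d20; rewrite dw0 /= mulr0 subr0 add0r => d10 d20.
  by rewrite /line d10 d20; ring.
have e1 : num w / den w * den w = num w by rewrite mulfVK.
move: (num w / den w) (e1) (tau_boundary ngw gw e1) => z {e1} e1 bz.
have n1z : n1 s t = Re z * d1 s t - Im z * d2 s t.
  rewrite n10 d10 d20 -e1; case: (z) (den w) => [z1 z2] [v1 v2] /=; ring.
have n2z : n2 s t = Re z * d2 s t + Im z * d1 s t.
  rewrite n20 d10 d20 -e1; case: (z) (den w) => [z1 z2] [v1 v2] /=; ring.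
have circ0 r : circ r s t =
    (Re z ^+ 2 + Im z ^+ 2 - r ^+ 2) * (d1 s t ^+ 2 + d2 s t ^+ 2).
  rewrite /circ n1z n2z; ring.
have line0 : line (sin gamma) s t * line (- sin gamma) s t =
    (cos gamma ^+ 2 * (Re z ^+ 2 + Im z ^+ 2)
      - (cos gamma ^+ 2 + sin gamma ^+ 2) * Re z ^+ 2) *
    (d1 s t ^+ 2 + d2 s t ^+ 2) ^+ 2.
  rewrite /line n1z n2z; ring.
rewrite cos2Dsin2 in line0.
case: bz => hz.
- by rewrite circ0 -cabs_sqr hz subrr !mul0r.
- by rewrite (circ0 beta) -cabs_sqr hz subrr !(mul0r, mulr0).
- by rewrite line0 -cabs_sqr hz mul1r exprMn subrr !(mul0r, mulr0).
Qed.

Lemma quadratic_eq0 (f : R -> R) (a b c : R) :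
    (forall t, f t = a + b * t + c * t ^+ 2) ->
    (forall t, f t = 0) -> [/\ a = 0, b = 0 & c = 0].
Proof.
move=> fE f0; have := f0 0; have := f0 1; have := f0 (-1).
by rewrite !fE; split; lra.
Qed.

(** Otherwise the origin, a point of the gear, would be mapped to infinity. *)
Lemma A_neq0 : 0 < x ^+ 2 + y ^+ 2.
Proof.
have g0 : gear 0 by apply/gearP => //; left; rewrite cabs0.
have [w' _ /den_neq0] := tau_gear g0.
rewrite /den conjc0 mulr0 add0r /A eq_complex /= oppr_eq0 negb_and.
move=> /orP[h|h]; [apply: ltr_pwDl|apply: ltr_wpDl]; rewrite ?sqr_ge0 //.
  by rewrite lt_def sqr_ge0 sqrf_eq0 h.
by rewrite lt_def sqr_ge0 sqrf_eq0 h.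
Qed.

(** If [tau] maps the circle of radius [|s|] centered at 0 into the circle of
    radius [r] centered at 0, then [r = |s|] and [B = - s^2 C]. *)
Lemma circ_eq0 r s : s != 0 -> (forall t, circ r s t = 0) -> B = - (s ^+ 2 * C).
Proof.
move=> s0 /(@quadratic_eq0 _ (n1 s 0 ^+ 2 + n2 s 0 ^+ 2
  - r ^+ 2 * (d1 s 0 ^+ 2 + d2 s 0 ^+ 2))
  (- 4 * s * x * (B + r ^+ 2 * C)) (s ^+ 2 * x ^+ 2 + (s * y - B) ^+ 2
    - r ^+ 2 * (x ^+ 2 + (y + C * s) ^+ 2))).
case; first by move=> t; rewrite /circ /n1 /n2 /d1 /d2; ring.
rewrite /n1 /n2 /d1 /d2 => e0 e1 e2.
have e3 : s * y * (B + r ^+ 2 * C) = 0 by nra.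
have e4 : s ^+ 2 * (x ^+ 2 + y ^+ 2) + B ^+ 2
    - r ^+ 2 * (x ^+ 2 + y ^+ 2) - r ^+ 2 * C ^+ 2 * s ^+ 2 = 0 by nra.
have BE : B = - (r ^+ 2 * C).
  apply/eqP; rewrite -subr_eq0 opprK; apply/negP => /negP h.
  have y0 : y = 0 by apply/eqP; move/eqP: e3;
    rewrite !mulf_eq0 (negPf s0) (negPf h) orbF.
  have x0 : x = 0.
    apply/eqP; move/eqP: e1; rewrite !mulf_eq0 (negPf s0) (negPf h) orbF
      oppr_eq0.
    by rewrite pnatr_eq0.
  by have := A_neq0; rewrite x0 y0 expr0n addr0 ltxx.
have : (x ^+ 2 + y ^+ 2 + B * C) * (s ^+ 2 - r ^+ 2) = 0.
  by rewrite -e4 BE; ring.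
move=> /eqP; rewrite mulf_eq0 (gt_eqF det_gt0) /= subr_eq0 => /eqP ->.
exact: BE.
Qed.

(** The same for the line through 0 and [cos gamma + i a]. With
    [f = Re ((cos gamma - i a) A)], the equations make the determinant equal to
    [2 f^2], so that [f] is nonzero. *)
Lemma line_eq0 a s : s != 0 -> cos gamma ^+ 2 + a ^+ 2 = 1 ->
  (forall t, line a s t = 0) -> B = s ^+ 2 * C.
Proof.
set c := cos gamma => s0 ca.
set f := c * x + a * y.
set I := c * (2 * x * y) - a * (x ^+ 2 - y ^+ 2 + B * C).
set J := c * (x ^+ 2 - y ^+ 2 - B * C) + 2 * a * x * y.
move=> /(@quadratic_eq0 _ (s * I - f * (C * s ^+ 2 - B)) (- 2 * s * J)
  (- s * I - f * (C * s ^+ 2 - B))).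
case; first by move=> t; rewrite /line /n1 /n2 /d1 /d2 /f /I /J -/c; ring.
move=> e0 e1 e2.
have sI0 : s * I = 0 by lra.
have fB : f * (C * s ^+ 2 - B) = 0 by lra.
have I0 : I = 0 by apply/eqP; move/eqP: sI0; rewrite mulf_eq0 (negPf s0).
have J0 : J = 0.
  by apply/eqP; move/eqP: e1; rewrite !mulf_eq0 (negPf s0) oppr_eq0 pnatr_eq0.
have S2 : (x ^+ 2 + y ^+ 2 + B * C) = 2 * f ^+ 2 - c * J - a * I.
  transitivity ((c ^+ 2 + a ^+ 2) * (x ^+ 2 + y ^+ 2 + B * C)).
    by rewrite ca mul1r.
  by rewrite /f /I /J; ring.
have f0 : f != 0.
  apply/eqP => f0; move: det_gt0.
  by rewrite S2 I0 J0 f0 expr0n !mulr0 !subr0 ltxx.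
apply/eqP; rewrite -subr_eq0 -oppr_eq0 opprB [s ^+ 2 * C]mulrC.
by move/eqP: fB; rewrite mulf_eq0 (negPf f0).
Qed.

(** Boundary arcs of the gear around the points [s = -1] and [s = beta]: the
    product of the four pulled back equations is a polynomial in [t] that has
    infinitely many roots, so one factor is zero. *)
Lemma arc_image (s e : R) : s != 0 -> 0 < e ->
    (forall t, 0 < t < e -> ~ gear (circle_pt s t) /\
      forall r, 0 < r < 1 -> gear ((1 - r)%:C * circle_pt s t)) ->
  B = s ^+ 2 * C \/ B = - (s ^+ 2 * C).
Proof.
move=> s0 e0 harc.
pose pn1 : {poly R} := (s * x)%:P + (s * y - B)%:P * 'X.
pose pn2 : {poly R} := (s * y + B)%:P - (s * x)%:P * 'X.
pose pd1 : {poly R} := x%:P + (y + C * s)%:P * 'X.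
pose pd2 : {poly R} := (C * s - y)%:P + x%:P * 'X.
pose pcirc r : {poly R} := pn1 ^+ 2 + pn2 ^+ 2
  - (r ^+ 2)%:P * (pd1 ^+ 2 + pd2 ^+ 2).
pose pline a : {poly R} := (cos gamma)%:P * (pn2 * pd1 - pn1 * pd2)
  - a%:P * (pn1 * pd1 + pn2 * pd2).
have circE r t : (pcirc r).[t] = circ r s t by rewrite /circ !hornerE.
have lineE a t : (pline a).[t] = line a s t by rewrite /line !hornerE.
have : pcirc 1 * pcirc beta * (pline (sin gamma) * pline (- sin gamma)) = 0.
  apply: (poly_eq0_near0 e0) => t /harc[ngw gw].
  by rewrite !hornerM !circE !lineE; exact: boundary_forms.
have cs := cos2Dsin2 gamma.
move=> /eqP; rewrite !mulf_eq0 -orbA => /or4P[] /eqP p0.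
- by right; apply: (@circ_eq0 1) => // t; rewrite -circE p0 horner0.
- by right; apply: (@circ_eq0 beta) => // t; rewrite -circE p0 horner0.
- by left; apply: (@line_eq0 (sin gamma)) => // t; rewrite -lineE p0 horner0.
- left; apply: (@line_eq0 (- sin gamma)) => //; first by rewrite sqrrN.
  by move=> t; rewrite -lineE p0 horner0.
Qed.

Lemma cabs_circle_pt s t : cabs (circle_pt s t) = `|s|.
Proof.
have t1 : 1 + t ^+ 2 != 0 by rewrite lt0r_neq0 // ltr_wpDr ?sqr_ge0.
apply/cabs_eq_sqr; first exact: normr_ge0.
by rewrite real_normK ?num_real //=; field.
Qed.

(** For small [t] the argument of [circle_pt s t] is close to that of [s]. *)
Lemma Re_circle_pt : exists2 e : R, 0 < e &
  forall t, 0 < t < e -> `|cos gamma| < (1 - t ^+ 2) / (1 + t ^+ 2).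
Proof.
have c1 := abs_cos_lt1 gamma_itv; have c0 := normr_ge0 (cos gamma).
exists ((1 - `|cos gamma|) / 2); first by lra.
move=> t /andP[t0 te]; have t1 : 0 < 1 + t ^+ 2 by rewrite ltr_wpDr ?sqr_ge0.
by rewrite ltr_pdivlMr //; nra.
Qed.

(** The circles of radius 1 and [beta] give [B = C] or [B = - C], and
    [B = beta^2 C] or [B = - beta^2 C]. *)
Lemma tau_linear : B = 0 /\ C = 0.
Proof.
have [e e0 he] := Re_circle_pt.
have b0 : 0 < beta by apply: lt_trans beta_gt1.
(* the inner arc, around -1 *)
have hin : B = (-1) ^+ 2 * C \/ B = - ((-1) ^+ 2 * C).
  apply: (arc_image _ e0); first by rewrite oppr_eq0 oner_eq0.
  move=> t /he ht; split.
    move=> /(gearP _ gamma_itv); rewrite cabs_circle_pt normrN1 ltxx mulr1.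
    rewrite /= -mulrA; case=> // -[_]; move: ht;
      rewrite ltr_norml => /andP[? _]; lra.
  move=> r /andP[r0 r1]; apply/gearP => //; left.
  by rewrite cabsM cabs_circle_pt normrN1 mulr1 cabsC gtr0_norm; lra.
(* the outer arc, around beta *)
have hout : B = beta ^+ 2 * C \/ B = - (beta ^+ 2 * C).
  apply: (arc_image _ e0); first exact: lt0r_neq0.
  move=> t /he ht; split.
    move=> /(gearP _ gamma_itv); rewrite cabs_circle_pt gtr0_norm // ltxx.
    by case=> [h|[]//]; have := lt_trans h beta_gt1; rewrite ltxx.
  move=> r /andP[r0 r1]; apply/gearP => //; right.
  rewrite cabsM cabs_circle_pt cabsC (gtr0_norm b0) gtr0_norm ?subr_gt0 //.
  split; first by rewrite gtr_pMl //; lra.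
  have -> : Re ((1 - r)%:C * circle_pt beta t) =
    (1 - r) * beta * ((1 - t ^+ 2) / (1 + t ^+ 2)) by rewrite /=; ring.
  rewrite mulrC ltr_pM2l ?mulr_gt0 ?subr_gt0 //.
  by apply: le_lt_trans ht; exact: ler_norm.
have C0 : C = 0.
  apply/eqP; apply/negP => /negP C0.
  have b2 : 1 < beta ^+ 2 by rewrite expr_gt1 // ltW.
  rewrite sqrrN expr1n mul1r in hin.
  have : beta ^+ 2 * C = C \/ beta ^+ 2 * C = - C.
    by case: hin; case: hout => -> h; rewrite ?h; lra.
  by case=> /eqP; rewrite -subr_eq0 -?opprD -?mulrBl ?opprK; nra.
by split => //; case: hin => ->; rewrite C0 mulr0 ?oppr0.
Qed.

Lemma tau_not_gear w z : ~ gear w -> z * den w = num w -> ~ gear z.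
Proof.
by move=> ngw e gz; have [w' gw' /(tau_involutive e) e2] := tau_gear gz;
  rewrite e2 in gw'.
Qed.

(** Now [tau w = u * conj w] with [u = A / conj A = A^2 / |A|^2]. *)
Lemma tau_rotation w z : z * den w = num w ->
  cabs z = cabs w /\
  (x ^+ 2 + y ^+ 2) * Re z = (x ^+ 2 - y ^+ 2) * Re w + 2 * x * y * Im w.
Proof.
have [B0 C0] := tau_linear; have A0 := A_neq0 => e.
have {}e : z * conjc A = A * conjc w.
  by move: e; rewrite /den /num B0 C0 mul0r add0r addr0.
split.
  apply: (@mulIf _ (cabs A)).
    by apply/eqP => /cabs_eq0 hA; move: A0; case: hA => -> ->;
      rewrite expr0n addr0 ltxx.
  by rewrite -{1}(cabs_conj A) -cabsM e cabsM cabs_conj mulrC.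
have : Re (z * conjc A * A) = Re (A * conjc w * A) by rewrite e.
rewrite /A; case: (z) (w) => z1 z2 [u v] /= h.
by transitivity ((z1 * x - z2 * - y) * x - (z1 * - y + z2 * x) * y);
  [ring | rewrite h; ring].
Qed.

(** The factor [u = (U + iV) / N] is 1. The points of argument [+- gamma] bound
    the tooth. If [cos gamma <= 0], one uses that they are outside the gear, as
    are their images; if [cos gamma > 0], that points of the tooth near them
    have their images in the tooth. In both cases the inequalities for the two signs,
    together with [cos gamma < U / N] when [cos gamma = 0], give [N <= U]. *)
Lemma tau_conj : y = 0.
Proof.
have N0 := A_neq0; set N := x ^+ 2 + y ^+ 2 in N0.
set U := x ^+ 2 - y ^+ 2; set V := 2 * x * y.
have NUV : N ^+ 2 = U ^+ 2 + V ^+ 2 by rewrite /N /U /V; ring.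
have b0 : 0 < beta by apply: lt_trans beta_gt1.
have s0 := sin_gamma_gt0 gamma_itv.
have c1 := abs_cos_lt1 gamma_itv; rewrite ltr_norml in c1;
  have /andP[c1a c1b] := c1.
have cs := cos2Dsin2 gamma.
set c := cos gamma in cs c1a c1b *; set s := sin gamma in s0 cs.
suff NU : N <= U.
  by apply/eqP; rewrite -sqrf_eq0 eq_le sqr_ge0 andbT; move: NU;
    rewrite /N /U; lra.
(* the image of a point of the tooth is in the tooth *)
have in_tooth u v : cabs (u +i* v) < beta -> 1 <= cabs (u +i* v) ->
    c * cabs (u +i* v) < u -> N * (c * cabs (u +i* v)) < U * u + V * v.
  move=> m1 m2 m3.
  have gw : gear (u +i* v) by apply/gearP => //; right.
  have [z gz /tau_rotation[cz hz]] := tau_gear gw.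
  move: hz; rewrite -/N -/U -/V /= => <-; rewrite ltr_pM2l // -cz.
  by move: gz => /(gearP _ gamma_itv)[|[]//]; rewrite cz ltNge m2.
have realp : c * N < U.
  have [r r1 rb] : exists2 r : R, 1 < r & r < beta.
    by have [? ?] := midf_lt beta_gt1; exists ((1 + beta) / 2).
  have r0 : 0 < r := lt_trans ltr01 r1.
  have cr : cabs (r +i* 0) = r by rewrite -[LHS]/(cabs r%:C) cabsC gtr0_norm.
  have := in_tooth r 0; rewrite cr rb (ltW r1) gtr_pMl // c1b =>
    /(_ isT isT isT).
  by rewrite mulr0 addr0 mulrCA mulrA ltr_pM2r.
have [c_le0|c_gt0] := leP c 0.
  have side v : v ^+ 2 = s ^+ 2 -> U * c + V * v <= c * N.
    move=> vs; have m1 : cabs (c +i* v) = 1.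
      by apply/cabs_eq_sqr => //=; rewrite vs expr1n.
    have ng : ~ gear (c +i* v).
      by move=> /(gearP _ gamma_itv); rewrite m1 ltxx mulr1 /= ltxx;
        case=> [|[]].
    have [B0 C0] := tau_linear.
    have d0 : den (c +i* v) != 0.
      rewrite /den C0 mul0r add0r conjc_eq0; apply/eqP => -[x0 y0].
      by move: N0; rewrite /N x0 y0 expr0n addr0 ltxx.
    have e : num (c +i* v) / den (c +i* v) * den (c +i* v) = num (c +i* v)
      by rewrite mulfVK.
    move: (_ / _) e => z e.
    have [cz hz] := tau_rotation e; have ngz := tau_not_gear ng e.
    move: hz; rewrite m1 in cz; rewrite -/N -/U -/V /= => <-.
    rewrite mulrC ler_pM2r // leNgt; apply/negP => h.
    by apply: ngz; apply/gearP => //; right; rewrite cz mulr1.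
  have h1 := side s erefl; have h2 := side (- s) (sqrrN s).
  have [c0|c0] := eqVneq c 0.
    have V0 : V = 0 by nra.
    have : N ^+ 2 <= U ^+ 2 by rewrite NUV V0 expr0n addr0.
    by rewrite ler_sqr // nnegrE ltW //; rewrite c0 mul0r in realp.
  have c_lt0 : c < 0 by rewrite lt_def eq_sym c0.
  rewrite -(ler_nM2r c_lt0); lra.
(* the points c + e +- i s are in the tooth sector for every e > 0; this e is
   small enough to contradict U < N *)
rewrite leNgt; apply/negP => UN.
pose e := Num.min (c * (N - U) / N) ((beta - 1) / 2).
have e0 : 0 < e.
  by rewrite lt_min !divr_gt0 ?mulr_gt0 ?subr_gt0.
have e1 : e * N <= c * (N - U) by rewrite -ler_pdivlMr // ge_min lexx.
have e2 : e <= (beta - 1) / 2 by rewrite ge_min lexx orbT.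
have edge v : v ^+ 2 = s ^+ 2 -> N * c < U * (c + e) + V * v.
  move=> vs; set m := cabs ((c + e) +i* v).
  have m2 : m ^+ 2 = 1 + 2 * c * e + e ^+ 2.
    rewrite cabs_sqr /= vs; transitivity (c ^+ 2 + s ^+ 2 + 2 * c * e + e ^+ 2).
      by ring.
    by rewrite cs.
  have m0 : 0 <= m := cabs_ge0 _.
  have m1 : 1 <= m by rewrite -(@ler_sqr _ 1 m) ?nnegrE // m2; nra.
  apply: le_lt_trans (_ : N * (c * m) < _);
    first by rewrite ler_pM2l // ler_peMr // ltW.
  apply: in_tooth => //; rewrite -/m.
    have eb : 1 + e < beta by apply: le_lt_trans (midf_lt beta_gt1).2; lra.
    have ce : c * e <= e by rewrite ger_pMl // ltW.
    have : m ^+ 2 < beta ^+ 2 by rewrite m2; nra.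
    by rewrite ltr_sqr // nnegrE ltW.
  rewrite -(@ltr_sqr _ (c * m)) ?nnegrE; [|nra|lra].
  have : 0 < s ^+ 2 * (2 * c * e + e ^+ 2) by rewrite mulr_gt0 ?exprn_gt0 //;
    nra.
  by rewrite exprMn m2 -subr_gt0; congr (_ < _);
    rewrite (_ : s ^+ 2 = 1 - c ^+ 2); [ring|lra].
have h1 := edge s erefl; have h2 := edge (- s) (sqrrN s).
have : U * (c + e) <= N * c by nra.
lra.
Qed.

End Reflection.

(** * Pregears with a finite pole *)

Section PointedForm.
Variable R : realType.
Implicit Types (P : pregear R) (S : set R[i]).

(** The image of [S] by [w |-> a + k / (w - q)], without the point at infinity.
    This is the normal form of a non-affine Moebius map: [q] is its pole and [a]
    is the image of infinity. *)
Definition pointed_image (a k q : R[i]) S : set R[i] :=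
  [set z | exists2 w, S w & w != q /\ z = a + k / (w - q)].

Lemma pregear_affine P : pg_c P = 0 -> is_gear (pg_domain P).
Proof.
move=> c0; have := pg_det P; rewrite c0 mulr0 subr0 mulf_eq0 negb_or =>
  /andP[a0 d0].
exists (pg_b P / pg_d P), (pg_ratio P), (pg_angle P); split.
- exact: pg_ratio_gt1.
- exact: pg_angle_itv.
exists (pg_a P / pg_d P); first by rewrite mulf_neq0 ?invr_eq0.
apply/seteqP; split=> z /=; rewrite /pg_domain /pg_image c0 /=.
  by move=> [w gw [_ ->]]; exists w => //; rewrite mul0r add0r mulrDl mulrAC.
move=> [w gw <-]; exists w => //; rewrite mul0r add0r; split=> //.
by rewrite mulrDl mulrAC.
Qed.

Lemma pregear_pointed P : pg_c P != 0 -> exists a k q : R[i],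
  k != 0 /\ forall S, pg_image P S = pointed_image a k q S.
Proof.
move=> c0; have det := pg_det P.
exists (pg_a P / pg_c P), (- (pg_a P * pg_d P - pg_b P * pg_c P) / pg_c P ^+ 2),
  (- pg_d P / pg_c P).
split; first by rewrite mulf_neq0 ?oppr_eq0 // invr_eq0 expf_neq0.
have wcd w : w * pg_c P - - pg_d P = pg_c P * w + pg_d P by ring.
move=> S; apply/seteqP; split=> z [w Sw [h ->]]; exists w => //.
  split; last by field; rewrite c0 wcd h.
  by apply: contra_neq h => ->; rewrite mulrC divfK // addNr.
have h' : pg_c P * w + pg_d P != 0.
  apply: contra_neq h => h; apply: (canRL (mulfK c0)).
  by apply/eqP; rewrite mulrC -addr_eq0 h.
by split=> //; field; rewrite ?wcd c0 h'.
Qed.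

(** If the pole were in the gear, then the image would contain all large real
    numbers. *)
Lemma pole_not_in_gear (beta gamma : R) (a k q : R[i]) (pp : R) :
    0 < gamma < pi ->
    (forall x : R, pointed_image a k q (std_gear beta gamma) x%:C -> x < pp) ->
    k != 0 -> ~ std_gear beta gamma q.
Proof.
move=> g_itv bd k0 /(gear_open g_itv)[e e0 he].
(* x is beyond pp, and so large that its preimage is within e of q *)
pose x := Num.max pp (Re a + cabs k / e + 1).
have xpp : pp <= x by rewrite le_max lexx.
suff : x < pp by rewrite ltNge xpp.
have k1 : 0 < cabs k by rewrite lt_def cabs_ge0 andbT; apply: contra_neq k0;
  exact: cabs_eq0.
have hx : cabs k / e < cabs (x%:C - a).
  apply: lt_le_trans (Re_le _); rewrite raddfB /= ltrBrDl lt_max; apply/orP;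
    right.
  by rewrite ltrDl.
have xa0 : x%:C - a != 0.
  apply/eqP => h; move: hx; rewrite h cabs0; apply/negP.
  by rewrite -leNgt divr_ge0 // ltW.
apply: bd; exists (q + k / (x%:C - a)).
  apply: he; rewrite addrAC subrr add0r.
  have -> : cabs (k / (x%:C - a)) = cabs k / cabs (x%:C - a).
    apply: (@mulIf _ (cabs (x%:C - a))).
      by apply: contra_neq xa0; exact: cabs_eq0.
    rewrite -cabsM !divfK //; apply: contra_neq xa0; exact: cabs_eq0.
  have : 0 < cabs (x%:C - a) by apply: lt_trans hx; exact: divr_gt0.
  by move=> h; rewrite ltr_pdivrMr // mulrC -ltr_pdivrMr.
split; last by rewrite [q + _]addrC addrK invf_div mulrC divfK // subrKC.
by rewrite -subr_eq0 addrAC subrr add0r mulf_neq0 ?invr_eq0.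
Qed.

(** If the image of the gear is symmetric in the real axis, then the Moebius map
    is real. *)
Lemma symmetric_pointed_real (beta gamma : R) (a k q : R[i])
    (D := pointed_image a k q (std_gear beta gamma)) :
    1 < beta -> 0 < gamma < pi -> k != 0 -> ~ std_gear beta gamma q ->
    (forall z, D z -> D (conjc z)) ->
  [/\ Im a = 0, Im k = 0 & Im q = 0].
Proof.
move=> b1 g_itv k0 ngq symD.
have kn0 : 0 < Re k ^+ 2 + Im k ^+ 2.
  rewrite -cabs_sqr exprn_gt0 // lt_def cabs_ge0 andbT.
  by apply: contra_neq k0; exact: cabs_eq0.
(* x + iy, B and C are the coefficients of M^-1 o conj o M *)
pose x := Re k + 2 * Im a * Im q.
pose y := Im k - 2 * Im a * Re q.
pose B := 2 * (Im q * Re k - Re q * Im k) + 2 * Im a * (Re q ^+ 2 + Im q ^+ 2).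
pose C := - (2 * Im a).
have S0 : 0 < x ^+ 2 + y ^+ 2 + B * C.
  suff -> : x ^+ 2 + y ^+ 2 + B * C = Re k ^+ 2 + Im k ^+ 2 by [].
  by rewrite /x /y /B /C; ring.
have tau w : std_gear beta gamma w -> exists2 w', std_gear beta gamma w' &
    w' * ((0 +i* C) * conjc w + conjc (x +i* y)) =
    (x +i* y) * conjc w + (0 +i* B).
  move=> gw; have wq : w != q by apply: contra_not_neq ngq => <-.
  have [|w' gw' [w'q e]] := symD (a + k / (w - q)); first by exists w.
  exists w' => //.
  have wq' : conjc w - conjc q != 0 by rewrite -rmorphB conjc_eq0 subr_eq0.
  have w'q' : w' - q != 0 by rewrite subr_eq0.
  have {}e : k * (conjc w - conjc q) =
      (w' - q) * ((conjc a - a) * (conjc w - conjc q) + conjc k).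
    apply/eqP; rewrite -subr_eq0; apply/eqP.
    transitivity ((w' - q) * (conjc w - conjc q) *
      ((a + k / (w' - q)) - (conjc a + conjc k / (conjc w - conjc q)))).
      by field; rewrite w'q' wq'.
    by rewrite -e rmorphD rmorphM fmorphV rmorphB subrr mulr0.
  have -> : (0 +i* C) * conjc w + conjc (x +i* y) =
      (conjc a - a) * (conjc w - conjc q) + conjc k.
    rewrite /x /y /C; case: (a) (k) (q) (w) =>
      [a1 a2] [k1 k2] [q1 q2] [w1 w2] /=.
    by apply/eqP; rewrite eq_complex /=; apply/andP; split; apply/eqP; ring.
  have -> : (x +i* y) * conjc w + (0 +i* B) =
      q * ((conjc a - a) * (conjc w - conjc q) + conjc k) +
      k * (conjc w - conjc q).
    rewrite /x /y /B; case: (a) (k) (q) (w) =>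
      [a1 a2] [k1 k2] [q1 q2] [w1 w2] /=.
    by apply/eqP; rewrite eq_complex /=; apply/andP; split; apply/eqP; ring.
  by rewrite e; ring.
have [B0 C0] := tau_linear b1 g_itv S0 tau.
have y0 := tau_conj b1 g_itv S0 tau.
have a0 : Im a = 0 by rewrite /C in C0; lra.
have kk : Im k = 0 by move: y0; rewrite /y a0; lra.
split=> //; move: B0 kn0; rewrite /B a0 kk expr0n addr0 => h.
have {}h : Im q * Re k = 0 by lra.
move=> hk; apply/eqP; move/eqP: h; rewrite mulf_eq0 => /orP[//|/eqP h].
by rewrite h expr0n ltxx in hk.
Qed.

End PointedForm.

(** * The real trace and the circles of the tooth edges *)

Section RealPole.
Variable R : realType.

Lemma real_std_gear (beta gamma x : R) : 1 < beta -> 0 < gamma < pi ->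
  std_gear beta gamma x%:C <-> -1 < x < beta.
Proof.
move=> b1 g_itv; have := abs_cos_lt1 g_itv; rewrite ltr_norml => /andP[c1 c2].
rewrite gearP // cabsC /=; split.
  case=> [|[]]; first by rewrite ltr_norml => /andP[h1 h2];
    rewrite h1 (lt_trans h2).
  move=> hb hc; rewrite (le_lt_trans (ler_norm _) hb) andbT.
  case: (lerP 0 x) hc => [x0 _|x0]; first by apply: lt_le_trans x0; lra.
  by rewrite ltr0_norm //; nra.
move=> /andP[h1 h2]; case: (ltP x 1) => x1.
  by left; rewrite ltr_norml h1 x1.
right; rewrite gtr0_norm; last by apply: lt_le_trans x1.
by split=> //; rewrite gtr_pMl //; apply: lt_le_trans x1.
Qed.

Lemma unbounded_inv (a k l u : R) : k != 0 ->
  ~ (forall s, 0 < s < 1 -> l < a + k / s < u).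
Proof.
move=> k0 h; pose m := `|l| + `|u| + `|a| + `|k| + 1.
have m0 : 0 < m by rewrite /m ltr_wpDl ?addr_ge0.
have k1 : 0 < `|k| by rewrite normr_gt0.
have := h (`|k| / m).
have [n1 n2 n3] : [/\ 0 <= `|l|, 0 <= `|u| & 0 <= `|a|] by rewrite !normr_ge0.
rewrite divr_gt0 //= ltr_pdivrMr // mul1r /m => /(_ _) /andP[]; first by lra.
rewrite -/m invf_div.
have [l1 l2] : - l <= `|l| /\ u <= `|u| by rewrite -normrN !ler_norm.
have [a1 a2] : - a <= `|a| /\ a <= `|a| by rewrite -{1}normrN !ler_norm.
have mE : m = `|l| + `|u| + `|a| + `|k| + 1 by [].
have [kp|kn|k00] := ltrgtP 0 k.
- by rewrite (gtr0_norm kp) mulrC divfK //; rewrite (gtr0_norm kp) in mE; lra.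
- rewrite (ltr0_norm kn) invrN mulrN mulrN.
  rewrite [k * _]mulrC divfK //; rewrite (ltr0_norm kn) in mE; lra.
- by rewrite -k00 eqxx in k0.
Qed.

Lemma open_itv_inj (l u l' u' : R) : l < u -> l' < u' ->
  (forall x, l < x < u <-> l' < x < u') -> l = l' /\ u = u'.
Proof.
move=> lu lu' h.
have half (a b c d : R) : a < b -> (forall x, a < x < b -> c < x < d) ->
  c <= a /\ b <= d.
  move=> ab H; have [m1 m2] := midf_lt ab.
  split; rewrite leNgt; apply/negP => bad.
    pose x := Num.min c ((a + b) / 2).
    have : a < x < b by rewrite lt_min bad m1 gt_min m2 orbT.
    by move=> /H /andP[]; rewrite lt_min ltxx.
  pose x := Num.max d ((a + b) / 2).
  have : a < x < b by rewrite lt_max gt_max bad m2 m1 orbT.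
  by move=> /H /andP[_]; rewrite gt_max ltxx.
have [h1 h2] := half _ _ _ _ lu (fun x => (h x).1).
have [h3 h4] := half _ _ _ _ lu' (fun x => (h x).2).
by split; apply/eqP; rewrite eq_le ?h1 ?h2 ?h3 ?h4.
Qed.

(** The end points of the real trace are the images of [-1] and [beta], and the
    pole is not one of these two points, since the trace is bounded. *)
Lemma real_trace (beta a k q pm pp : R) : 1 < beta -> k != 0 -> pm < pp ->
    q <= -1 \/ beta <= q ->
    (forall x, pm < x < pp <-> x != a /\ -1 < q + k / (x - a) < beta) ->
  (q < -1 \/ beta < q) /\
  (pm = a + k / (-1 - q) /\ pp = a + k / (beta - q) \/
   pp = a + k / (-1 - q) /\ pm = a + k / (beta - q)).
Proof.
move=> b1 k0 lt hq htr.
have vals w : -1 < w < beta -> pm < a + k / (w - q) < pp.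
  move=> hw; have wq : w - q != 0.
    by rewrite subr_eq0; apply/eqP => wq; case/andP: hw; case: hq; lra.
  apply/htr; split; first by rewrite -subr_eq0 addrAC subrr add0r mulf_neq0
    ?invr_eq0.
  by rewrite [a + _]addrC addrK invf_div mulrC divfK // subrKC.
have q1 : q != -1.
  apply/eqP => q1; apply: (@unbounded_inv a k pm pp k0) => s /andP[s0 s1].
  by have := vals (s - 1); rewrite q1 opprK subrK; apply; lra.
have qb : q != beta.
  have Nk0 : - k != 0 by rewrite oppr_eq0.
  apply/eqP => qb; apply: (@unbounded_inv a (- k) pm pp Nk0) => s /andP[s0 s1].
  have := vals (beta - s); rewrite qb addrAC subrr add0r invrN mulrN -mulNr;
    apply; lra.
have hq' : q < -1 \/ beta < q.
  by case: hq => hq; [left|right]; rewrite lt_neqAle hq ?q1 // eq_sym qb.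
split=> //.
pose x1 := a + k / (-1 - q); pose x2 := a + k / (beta - q).
have d1 : -1 - q != 0 by case: hq' => h; apply/eqP; lra.
have d2 : beta - q != 0 by case: hq' => h; apply/eqP; lra.
have dd : 0 < (-1 - q) * (beta - q) by case: hq' => h; nra.
(* (x - x1) * (x - x2) has the sign of (w + 1) * (w - beta) *)
have trace x : pm < x < pp <-> (x - x1) * (x - x2) < 0.
  have [->|xa] := eqVneq x a.
    split; first by move/htr => [/eqP].
    have -> : (a - x1) * (a - x2) = k ^+ 2 / ((-1 - q) * (beta - q)).
      by rewrite /x1 /x2; field; rewrite d1 d2.
    by rewrite ltNge divr_ge0 ?sqr_ge0 // ltW.
  have xa0 : x - a != 0 by rewrite subr_eq0.
  pose w := q + k / (x - a).
  have -> : (x - x1) * (x - x2) =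
      (x - a) ^+ 2 / ((-1 - q) * (beta - q)) * ((w + 1) * (w - beta)).
    by rewrite /x1 /x2 /w; field; rewrite d1 d2 xa0.
  rewrite pmulr_rlt0; last first.
    by rewrite divr_gt0 // exprn_even_gt0.
  rewrite htr xa -/w; split=> [[_ /andP[? ?]]|h]; first by nra.
  by split=> //; apply/andP; split; nra.
have x12 : x1 != x2.
  rewrite -subr_eq0 (_ : x1 - x2 = k * (beta + 1) / ((-1 - q) * (beta - q))).
    by rewrite !mulf_neq0 ?invr_eq0 ?mulf_neq0 // lt0r_neq0 //; lra.
  by rewrite /x1 /x2; field; rewrite d1 d2.
have prodE (l u x : R) : l < u -> ((x - l) * (x - u) < 0) = (l < x < u).
  by move=> lu; apply/idP/andP => [h|[? ?]]; [split|]; nra.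
have [h12|h12|] := ltgtP x1 x2; last by move/eqP: x12.
  left; apply: open_itv_inj => // x; rewrite trace prodE //.
right; have [-> ->] // : pm = x2 /\ pp = x1.
by apply: open_itv_inj => // x; rewrite trace mulrC prodE.
Qed.

Lemma quadratic3_eq0 (a b c t1 t2 t3 : R) : t1 < t2 -> t2 < t3 ->
    a + b * t1 + c * t1 ^+ 2 = 0 -> a + b * t2 + c * t2 ^+ 2 = 0 ->
    a + b * t3 + c * t3 ^+ 2 = 0 -> a = 0 /\ c = 0.
Proof.
move=> h12 h23 e1 e2 e3.
have f1 : b + c * (t1 + t2) = 0.
  apply: (@mulIf _ (t2 - t1)); first by rewrite subr_eq0 gt_eqF.
  by rewrite mul0r -[RHS](subrr 0) -{1}e2 -e1; ring.
have f2 : b + c * (t2 + t3) = 0.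
  apply: (@mulIf _ (t3 - t2)); first by rewrite subr_eq0 gt_eqF.
  by rewrite mul0r -[RHS](subrr 0) -{1}e3 -e2; ring.
have c0 : c = 0.
  apply: (@mulIf _ (t3 - t1)); first
    by rewrite subr_eq0 gt_eqF // (lt_trans h12).
  by rewrite mul0r -[RHS](subrr 0) -{1}f2 -f1; ring.
by move: f1 e1; rewrite c0 !mul0r !addr0 => ->; rewrite mul0r addr0.
Qed.

(** A circle that contains the image of the tooth edge on the ray through
    [c + is] contains the images [a] of infinity and [a - k / q] of 0: its
    equation, pulled back to the ray, is a quadratic polynomial in [t], whose
    leading and constant coefficients express these two incidences. *)
Lemma tooth_circle (a k q : R) (c s beta : R) (c0 : R[i]) (r : R) :
    1 < beta -> s != 0 -> c ^+ 2 + s ^+ 2 = 1 -> q != 0 ->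
    (forall t, 1 <= t <= beta ->
       cabs (a%:C + k%:C / (t%:C * (c +i* s) - q%:C) - c0) = r) ->
  (a - Re c0) ^+ 2 + Im c0 ^+ 2 = r ^+ 2 /\
  (a - k / q - Re c0) ^+ 2 + Im c0 ^+ 2 = r ^+ 2.
Proof.
move=> b1 s0 cs q0 h.
pose x := a - Re c0; pose y := Im c0.
have [m1 m2] := midf_lt b1.
pose Q0 := (k - q * x) ^+ 2 + q ^+ 2 * y ^+ 2 - r ^+ 2 * q ^+ 2.
pose Q1 := 2 * (c * x * (k - q * x) + s * y * (k - q * x) + x * s * q * y
  - c * q * y ^+ 2)
  + r ^+ 2 * (2 * c * q).
pose Q2 := x ^+ 2 + y ^+ 2 - r ^+ 2.
have eqt t : 1 <= t <= beta -> Q0 + Q1 * t + Q2 * t ^+ 2 = 0.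
  move=> ht; have t0 : t != 0 by case/andP: ht => ? ?; apply/eqP; lra.
  pose w : R[i] := t%:C * (c +i* s) - q%:C.
  have w0 : w != 0.
    apply/eqP => -[_]; apply/eqP.
    by rewrite mul0r addr0 oppr0 addr0 mulf_neq0.
  have e : cabs ((a%:C - c0) * w + k%:C) = r * cabs w.
    by rewrite -(h t ht) -cabsM; congr cabs; rewrite -/w; field.
  have : cabs ((a%:C - c0) * w + k%:C) ^+ 2 = r ^+ 2 * cabs w ^+ 2.
    by rewrite e exprMn.
  rewrite !cabs_sqr /w.
  move: @x @y @Q0 @Q1 @Q2; case: (c0) => g1 g2 /= => e2.
  rewrite -[RHS](subrr (r ^+ 2 * ((t * c - 0 * s - q) ^+ 2 + (t * s + 0 * c
    - 0) ^+ 2))).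
  rewrite -{1}e2; transitivity (((k - q * (a - g1)) ^+ 2 + q ^+ 2 * g2 ^+ 2
    - r ^+ 2 * q ^+ 2) + t *
    (2 * (c * (a - g1) * (k - q * (a - g1)) + s * g2 * (k - q * (a - g1))
      + (a - g1) * s * q * g2 - c * q * g2 ^+ 2) + r ^+ 2 * (2 * c * q))
    + t ^+ 2 * ((c ^+ 2 + s ^+ 2) * ((a - g1) ^+ 2 + g2 ^+ 2 - r ^+ 2))).
    by rewrite cs; ring.
  by ring.
have [Z0 Z2] := quadratic3_eq0 m1 m2 (eqt 1 (introT andP (conj (lexx 1) (ltW
  b1))))
   (eqt _ (introT andP (conj (ltW m1) (ltW m2)))) (eqt beta (introT andP (conj
     (ltW b1) (lexx beta)))).
split; first by apply/eqP; rewrite -subr_eq0 -[X in X == _]/Q2 Z2.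
apply: (@mulIf _ (q ^+ 2)); first by rewrite expf_neq0.
apply/eqP; rewrite -subr_eq0 -[X in _ == X]Z0; apply/eqP; rewrite /Q0 /x /y;
  field.
done.
Qed.

End RealPole.

(** * The map T *)

Section Assembly.
Variable R : realType.

(** Two circles through the real points [a] and [m] and the nonreal point [p]
    coincide. *)
Lemma circle_center_unique (a m r r' : R) (p c0 c1 : R[i]) :
    a != m -> Im p != 0 -> 0 < r -> 0 < r' ->
    (a - Re c0) ^+ 2 + Im c0 ^+ 2 = r ^+ 2 ->
    (m - Re c0) ^+ 2 + Im c0 ^+ 2 = r ^+ 2 -> cabs (p - c0) = r ->
    (a - Re c1) ^+ 2 + Im c1 ^+ 2 = r' ^+ 2 ->
    (m - Re c1) ^+ 2 + Im c1 ^+ 2 = r' ^+ 2 -> cabs (p - c1) = r' ->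
  [/\ c1 = c0, r' = r & Re c0 = (a + m) / 2].
Proof.
(* the center is on the perpendicular bisector of [a, m] *)
have mid (c : R[i]) (u : R) : a != m -> (a - Re c) ^+ 2 + Im c ^+ 2 = u ->
    (m - Re c) ^+ 2 + Im c ^+ 2 = u -> Re c = (a + m) / 2.
  move=> am h1 h2; apply: (@mulIf _ (2 * (a - m))).
    by rewrite mulf_neq0 ?subr_eq0 // pnatr_eq0.
  apply/eqP; rewrite -subr_eq0; apply/eqP.
  transitivity (((m - Re c) ^+ 2 + Im c ^+ 2) - ((a - Re c) ^+ 2 + Im c ^+ 2)).
    by field.
  by rewrite h1 h2 subrr.
move=> am p0 r0 r'0 e1 e2 e3 e1' e2' e3'.
have Re0 := mid _ _ am e1 e2; have Re1 := mid _ _ am e1' e2'.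
have f3 : (Re p - Re c0) ^+ 2 + (Im p - Im c0) ^+ 2 = r ^+ 2.
  by rewrite -e3 cabs_sqr !raddfB.
have f3' : (Re p - Re c1) ^+ 2 + (Im p - Im c1) ^+ 2 = r' ^+ 2.
  by rewrite -e3' cabs_sqr !raddfB.
rewrite Re0 in e1 f3; rewrite Re1 in e1' f3'.
have ImE : Im c1 = Im c0.
  apply: (@mulIf _ (2 * Im p)); first by rewrite mulf_neq0 // pnatr_eq0.
  by rewrite -e1 in f3; rewrite -e1' in f3'; lra.
have cE : c1 = c0.
  by apply/eqP; rewrite eq_complex ImE Re0 Re1 !eqxx.
by split=> //; rewrite -e3' -e3 cE.
Qed.

Lemma dotE (u v : R[i]) : dot u v = Re u * Re v + Im u * Im v.
Proof.
rewrite /dot -[X in u * X]/(conjc v); case: u v => [u1 u2] [v1 v2] /=.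
by rewrite mulrN opprK.
Qed.

Lemma inward_normal_center (c0 p v : R[i]) (r : R) : 0 < r ->
    cabs (p - c0) = r -> `|v| = 1 -> dot v ('i * (p - c0)) = 0 ->
    0 < dot v (c0 - p) -> p + r%:C * v = c0.
Proof.
move=> r0 hr hv; rewrite !dotE => h1 h2.
have v1 : Re v ^+ 2 + Im v ^+ 2 = 1.
  by rewrite -cabs_sqr /cabs hv /= expr1n.
have n1 : (Re p - Re c0) ^+ 2 + (Im p - Im c0) ^+ 2 = r ^+ 2.
  by rewrite -hr cabs_sqr !raddfB.
move: h1 h2 v1 n1 {hr hv}; case: p v c0 => [p1 p2] [v1 v2] [g1 g2] /=.
rewrite !mul0r !mul1r => h1 h2 hv1 n1.
set l := v1 * (g1 - p1) + v2 * (g2 - p2) in h2.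
(* v is a unit vector parallel to c0 - p, so their dot product is |c0 - p| *)
have lr : l = r.
  apply/eqP; rewrite -(@eqrXn2 _ 2) ?ltW // -n1; apply/eqP.
  transitivity ((v1 ^+ 2 + v2 ^+ 2) * ((p1 - g1) ^+ 2 + (p2 - g2) ^+ 2)
     - (v1 * (0 - (p2 - g2)) + v2 * (0 + (p1 - g1))) ^+ 2).
    by rewrite /l; ring.
  by rewrite h1 hv1 expr0n subr0 mul1r.
have e1 : r * v1 = g1 - p1.
  rewrite -lr; transitivity ((v1 ^+ 2 + v2 ^+ 2) * (g1 - p1)
    + v2 * (v1 * (0 - (p2 - g2)) + v2 * (0 + (p1 - g1))));
      first by rewrite /l; ring.
  by rewrite h1 hv1 mulr0 mul1r addr0.
have e2 : r * v2 = g2 - p2.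
  rewrite -lr; transitivity ((v1 ^+ 2 + v2 ^+ 2) * (g2 - p2)
    - v1 * (v1 * (0 - (p2 - g2)) + v2 * (0 + (p1 - g1))));
      first by rewrite /l; ring.
  by rewrite h1 hv1 mulr0 mul1r subr0.
by apply/eqP; rewrite eq_complex /= !mul0r subr0 addr0 e1 e2 !subrKC !eqxx.
Qed.

Lemma Arg_polar (gamma kappa : R) : 0 < gamma < pi -> 0 < kappa ->
  Arg (kappa%:C * (cos gamma +i* sin gamma)) = gamma /\
  Arg (kappa%:C * (cos gamma +i* - sin gamma)) = - gamma.
Proof.
move=> g_itv k0; have s0 := sin_gamma_gt0 g_itv.
have m s : s ^+ 2 = sin gamma ^+ 2 -> cabs (kappa%:C * (cos gamma +i* s)) =
  kappa.
  move=> hs; rewrite cabsM cabsC gtr0_norm // (_ :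
    cabs (_ +i* _) = 1) ?mulr1 //.
  by apply/cabs_eq_sqr => //=; rewrite hs cos2Dsin2 expr1n.
have ac : acos (cos gamma) = gamma.
  by rewrite cosK // in_itv /=; case/andP: g_itv => ? ?; rewrite !ltW.
have kc : kappa * cos gamma / kappa = cos gamma
  by rewrite mulrAC divff ?mul1r // lt0r_neq0.
rewrite /Arg -!/(cabs _) !m ?sqrrN //= !mul0r !subr0 !addr0 kc ac.
by rewrite (mulr_ge0 (ltW k0) (ltW s0)) mulrN oppr_ge0 leNgt mulr_gt0.
Qed.

Lemma segmentC (u v : R[i]) : segment u v = segment v u.
Proof.
have sub (u' v' : R[i]) : segment u' v' `<=` segment v' u'.
  move=> z [t /andP[t0 t1] ->]; exists (1 - t).
    by apply/andP; split; lra.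
  by rewrite rmorphB rmorph1; ring.
by apply/seteqP; split; exact: sub.
Qed.

(** A tooth edge is the image of a segment of one of the rays of argument
    [+- gamma]. *)
Lemma tooth_edgeE (P : pregear R) E : is_tooth_edge P E -> exists2 s : R,
  s = sin (pg_angle P) \/ s = - sin (pg_angle P) &
  E = pg_image P [set w | exists2 t : R, 1 <= t <= pg_ratio P &
                          w = t%:C * (cos (pg_angle P) +i* s)].
Proof.
have b1 := pg_ratio_gt1 P; set b := pg_ratio P in b1 *.
have seg (e : R[i]) : segment (b%:C * e) e =
    [set w | exists2 t : R, 1 <= t <= b & w = t%:C * e].
  apply/seteqP; split=> z [t /andP[t0 t1] ->] /=.
    exists (b + t * (1 - b)); first by apply/andP; split; nra.
    by rewrite rmorphD rmorphM rmorphB rmorph1; ring.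
  have b10 : b - 1 != 0 by rewrite subr_eq0 gt_eqF.
  exists ((b - t) / (b - 1)).
    rewrite divr_ge0 ?subr_ge0 ?(ltW b1) //= ler_pdivrMr ?subr_gt0 // mul1r.
    by rewrite lerD2l lerN2.
  have tE : t = b + (b - t) / (b - 1) * (1 - b) by field.
  move: (_ / _) tE => u ->; ring.
case=> ->; rewrite -/b ?[segment _ (b%:C * _)]segmentC seg.
  by exists (sin (pg_angle P)); [left|].
by exists (- sin (pg_angle P)); [right|rewrite -/b /expi cosN sinN].
Qed.

Lemma real_pointed (a k q x : R) S : k != 0 ->
  pointed_image a%:C k%:C q%:C S x%:C <->
  x != a /\ S (q + k / (x - a))%:C.
Proof.
move=> k0; have kC : k%:C != 0 by rewrite (inj_eq (@complexI R)).
split=> [[w Sw [wq e]]|[xa Sw]].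
  have wq0 : w - q%:C != 0 by rewrite subr_eq0.
  have xaE : (x - a)%:C = k%:C / (w - q%:C) by rewrite rmorphB /= e addrC addKr.
  have xa : x - a != 0.
    by rewrite -(inj_eq (@complexI R)) xaE mulf_neq0 ?invr_eq0.
  split; first by rewrite -subr_eq0.
  by rewrite rmorphD fmorph_div /= xaE invf_div mulrC divfK // subrKC.
have xa0 : x - a != 0 by rewrite subr_eq0.
exists (q + k / (x - a))%:C => //; split.
  by rewrite (inj_eq (@complexI R)) -subr_eq0 addrC addKr mulf_neq0 ?invr_eq0.
by rewrite -rmorphB -fmorph_div -rmorphD; congr (_%:C);
  rewrite [q + _]addrC addrK invf_div mulrC divfK // subrKC.
Qed.

(** The one of [bm], [bp] inside the trace is [m], the image of 0, and the other
    one is [a], the image of infinity. So [T] after the Moebius map is linear. *)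
Lemma T_map_pointed (a k q pm pp : R) (m := a - k / q) (d := `|a - m| / 2) :
    k != 0 -> q != 0 -> pm < m < pp -> a < pm \/ pp < a ->
  exists kappa : R, [/\ kappa != 0, k < 0 -> 0 < kappa &
    forall w, w != q%:C ->
      T_map pm pp ((a + m) / 2 - d) ((a + m) / 2 + d)
        (a%:C + k%:C / (w - q%:C)) = kappa%:C * w].
Proof.
move=> k0 q0 /andP[pm_m m_pp] ha.
have kC : k%:C != 0 by rewrite (inj_eq (@complexI R)).
have qC : q%:C != 0 by rewrite (inj_eq (@complexI R)).
have quot w : w != q%:C ->
    (a%:C + k%:C / (w - q%:C) - m%:C) / (a%:C + k%:C / (w - q%:C) - a%:C)
    = w / q%:C.
  move=> wq; have wq0 : w - q%:C != 0 by rewrite subr_eq0.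
  rewrite /m rmorphB fmorph_div /= [a%:C + _]addrC addrK.
  by field; rewrite kC qC wq0.
case: ha => ha.
- have am : a - m < 0 by lra.
  have dE : d = - (a - m) / 2 by rewrite /d ltr0_norm.
  have -> : (a + m) / 2 - d = a by rewrite dE; field.
  have -> : (a + m) / 2 + d = m by rewrite dE; field.
  exists q^-1; split; first by rewrite invr_eq0.
    have : k / q < 0 by move: am; rewrite /m; lra.
    by move=> h kn; move: h; rewrite nmulr_rlt0.
  move=> w wq; rewrite /T_map pm_m m_pp ltNge (ltW ha) /= quot //.
  by rewrite fmorphV mulrC.
- have am : 0 < a - m by lra.
  have dE : d = (a - m) / 2 by rewrite /d gtr0_norm.
  have -> : (a + m) / 2 - d = m by rewrite dE; field.
  have -> : (a + m) / 2 + d = a by rewrite dE; field.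
  exists (- q^-1); split; first by rewrite oppr_eq0 invr_eq0.
    have : 0 < k / q by move: am; rewrite /m; lra.
    by move=> h kn; move: h; rewrite nmulr_rgt0 // oppr_gt0.
  move=> w wq; rewrite /T_map pm_m m_pp /= quot //.
  by rewrite rmorphN fmorphV mulNr mulrC.
Qed.

End Assembly.

Theorem proposition3p1 (R : realType) (P : pregear R)
  (D_sym : forall z : R[i], pg_domain P z -> pg_domain P z^*)
  (vertices_nonreal : forall z : R[i], pg_vertices P z -> Im z <> 0)
  (D_not_gear : ~ is_gear (pg_domain P))
  (pm pp : R) (lt_pm_pp : pm < pp)
  (D_real : forall x : R, pg_domain P x%:C <-> pm < x < pp)
  (rho : R)
  (rho_radius : forall E : set R[i], is_tooth_edge P E ->
     exists c0 : R[i], edge_circle E c0 rho)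
  (E : set R[i]) (E_tooth : is_tooth_edge P E)
  (p : R[i]) (p_in_E : E p) (p_interior : ~ pg_vertices P p)
  (v : R[i]) (v_normal : inward_unit_normal E p v) :
  let c := p + rho%:C * v in
  let d := Num.sqrt (rho ^+ 2 - (Im c) ^+ 2) in
  let bm := Re c - d in
  let bp := Re c + d in
  let T := T_map pm pp bm bp in
  exists beta gamma : R,
    gear_with (T @` pg_domain P) 0 beta gamma /\
    (pg_outer_edge P pp%:C ->
       beta%:C = - (T pp%:C / T pm%:C) /\
       gamma = if 0 < Im p then Arg (T p) else - Arg (T p)).
Proof.
move=> c d bm bp T; move: (pg_ratio_gt1 P) (pg_angle_itv P) => b1 g_itv.
set beta := pg_ratio P in b1; set gamma := pg_angle P in g_itv.
have c0 : pg_c P != 0 by apply/eqP => c0; exact: D_not_gear (pregear_affine c0).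
have [a [k [q [k0 imE]]]] := pregear_pointed c0.
have DE : pg_domain P = pointed_image a k q (std_gear beta gamma)
  by rewrite -imE.
have ngq : ~ std_gear beta gamma q.
  apply: (@pole_not_in_gear R beta gamma a k q pp) => // x.
  by rewrite -DE => /D_real /andP[].
have [Ima Imk Imq] : [/\ Im a = 0, Im k = 0 & Im q = 0].
  by apply: (symmetric_pointed_real b1 g_itv k0 ngq) => z; rewrite -DE;
    exact: D_sym.
move: a k q Ima Imk Imq k0 imE DE ngq.
move=> [a ?] [k ?] [q ?] /= -> -> -> kC imE DE ngq.
rewrite -!/(_%:C) in kC imE DE ngq.
have k0 : k != 0 by rewrite -(inj_eq (@complexI R)).
have qE : q <= -1 \/ beta <= q.
  case: (lerP q (-1)) => h1; [by left|right]; rewrite leNgt; apply/negP => h2.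
  by apply: ngq; apply/real_std_gear => //; rewrite h1.
have trace x : pm < x < pp <-> x != a /\ -1 < q + k / (x - a) < beta.
  by rewrite -D_real DE real_pointed // real_std_gear.
have [qE' ends] := real_trace b1 k0 lt_pm_pp qE trace.
have q0 : q != 0 by case: qE' => h; apply/eqP; lra.
set x1 := a + k / (-1 - q) in ends; set x2 := a + k / (beta - q) in ends.
have d1 : -1 - q != 0 by case: qE' => h; apply/eqP; lra.
have d2 : beta - q != 0 by case: qE' => h; apply/eqP; lra.
have dd : 0 < (-1 - q) * (beta - q) by case: qE' => h; nra.
have a_out : a < pm \/ pp < a.
  have : 0 < (a - pm) * (a - pp).
    have -> : (a - pm) * (a - pp) = k ^+ 2 / ((-1 - q) * (beta - q)).
      by case: ends => -[-> ->]; rewrite /x1 /x2; field; rewrite d1 d2.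
    by rewrite divr_gt0 // exprn_even_gt0.
  by case: (ltP a pm) => h1; [left|case: (ltP pp a) => h2; [right|nra]].
set m := a - k / q.
have m_in : pm < m < pp.
  have am : m - a = - (k / q) by rewrite /m addrC addKr.
  apply/trace; split.
    by rewrite -subr_eq0 am oppr_eq0 mulf_neq0 ?invr_eq0.
  have -> : q + k / (m - a) = 0 by rewrite am; field; rewrite q0 k0.
  by rewrite ltrN10 (lt_trans ltr01 b1).
have am : a != m by rewrite -subr_eq0 /m opprB addrCA subrr addr0 mulf_neq0
  ?invr_eq0.
(* the circle that carries E passes through a and m *)
have [s sE EE] := tooth_edgeE E_tooth.
rewrite imE -/beta -/gamma in EE.
have sg0 := sin_gamma_gt0 g_itv; rewrite -/gamma in sE.
have s0 : s != 0 by case: sE => ->; rewrite ?oppr_eq0 lt0r_neq0.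
have cs : cos gamma ^+ 2 + s ^+ 2 = 1 by case: sE => ->;
  rewrite ?sqrrN cos2Dsin2.
have tooth_neq t : 1 <= t -> t%:C * (cos gamma +i* s) != q%:C.
  move=> t1; apply/eqP => -[_]; apply/eqP.
  by rewrite mul0r addr0 mulf_neq0 // gt_eqF // (lt_le_trans ltr01).
have on_circle (c1 : R[i]) r : edge_circle E c1 r ->
    [/\ (a - Re c1) ^+ 2 + Im c1 ^+ 2 = r ^+ 2,
        (m - Re c1) ^+ 2 + Im c1 ^+ 2 = r ^+ 2 & cabs (p - c1) = r].
  move=> [r0 sub].
  have hE z : E z -> cabs (z - c1) = r by move=> /sub /eqc_cabs.
  have [h1 h2] : (a - Re c1) ^+ 2 + Im c1 ^+ 2 = r ^+ 2 /\
      (a - k / q - Re c1) ^+ 2 + Im c1 ^+ 2 = r ^+ 2.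
    apply: (tooth_circle b1 s0 cs q0) => t /andP[t1 tb].
    apply: hE; rewrite EE; exists (t%:C * (cos gamma +i* s)).
      by exists t => //; rewrite t1.
    by split=> //; exact: tooth_neq.
  by split=> //; exact: hE.
have [t /andP[t1 tb] pE] : exists2 t, 1 <= t <= beta &
    p = a%:C + k%:C / (t%:C * (cos gamma +i* s) - q%:C).
  by move: p_in_E; rewrite EE => -[_ [t ht ->] [_ ->]]; exists t.
have t0 : 0 < t by apply: lt_le_trans t1.
(* Im p has the sign of - k * s *)
have Imp : exists2 u : R, 0 < u & Im p = - k * s * u.
  pose X := t * cos gamma - q; pose Y := t * s.
  have Y0 : Y != 0 by rewrite mulf_neq0 // gt_eqF.
  have XY : 0 < X ^+ 2 + Y ^+ 2 by rewrite ltr_wpDl ?sqr_ge0 // exprn_even_gt0.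
  exists (t / (X ^+ 2 + Y ^+ 2)); first exact: divr_gt0.
  rewrite pE /= !(mul0r, addr0, subr0, add0r) -/Y -/X mulrN mulNr mulNr /Y;
    field.
  by rewrite gt_eqF.
have Imp0 : Im p != 0.
  by have [u u0 ->] := Imp; rewrite !mulf_neq0 ?oppr_eq0 // gt_eqF.
have [cr [r [cirE vn vt vd]]] := v_normal.
have [cr' cirE'] := rho_radius _ E_tooth.
have [e1 e2 e3] := on_circle _ _ cirE; have [f1 f2 f3] := on_circle _ _ cirE'.
have [crE rhoE ReE] := circle_center_unique am Imp0 cirE.1 cirE'.1 e1 e2 e3 f1
  f2 f3.
have cE : c = cr.
  by rewrite /c rhoE; apply: inward_normal_center; rewrite ?cirE.1.
have dE : d = `|a - m| / 2.
  rewrite /d cE rhoE -e1 addrK ReE.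
  have -> : a - (a + m) / 2 = (a - m) / 2 by field.
  by rewrite sqrtr_sqr normrM [`|2^-1|]gtr0_norm.
have [kappa [kap0 kap_gt0 TM]] := T_map_pointed k0 q0 m_in a_out.
have {}TM w : w != q%:C -> T (a%:C + k%:C / (w - q%:C)) = kappa%:C * w.
  by rewrite /T /bm /bp cE dE ReE; exact: TM.
move: T TM => T TM {bm bp d dE c cE}.
exists beta, gamma; split.
  split=> //; exists kappa%:C; first by rewrite (inj_eq (@complexI R)).
  rewrite DE; apply/seteqP; split=> z.
    by move=> [_ [w gw [wq ->]] <-]; exists w; rewrite ?TM ?addr0.
  move=> [w gw <-]; have wq : w != q%:C by apply: contra_not_neq ngq => <-.
  by exists (a%:C + k%:C / (w - q%:C)); [exists w|rewrite TM // addr0].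
rewrite /pg_outer_edge imE real_pointed // -/beta -/gamma => -[ppa [/eqc_cabs]].
rewrite cabsC => habs harg.
(* pp is the image of a real point of modulus beta and of argument at most
   gamma; this excludes - beta, whose argument is pi *)
have ppE : pp = x2.
  have [h|h] := leP 0 (q + k / (pp - a)).
    rewrite ger0_norm // in habs.
    have kE : k = (beta - q) * (pp - a).
      by rewrite -habs addrC addKr divfK // subr_eq0.
    by rewrite /x2 {1}kE mulrAC divff // mul1r subrKC.
  rewrite ltr0_norm // in habs.
  move: harg; rewrite abs_ArgE cabsC ltr0_norm // habs /= -habs invrN mulrN
    divff ?lt_eqF //.
  by rewrite acosN1 leNgt; case/andP: g_itv => _ ->.
have pmE : pm = x1.
  by case: ends => -[] // ppE' pmE; move: lt_pm_pp; rewrite pmE ppE ltxx.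
have k_lt0 : k < 0.
  have : 0 < x2 - x1 by rewrite -ppE -pmE subr_gt0.
  have -> : x2 - x1 = - k * ((beta + 1) / ((-1 - q) * (beta - q))).
    by rewrite /x1 /x2; field; rewrite d1 d2.
  rewrite pmulr_lgt0 ?oppr_gt0 //.
  by rewrite divr_gt0 // addr_gt0 // (lt_trans ltr01).
have kap : 0 < kappa := kap_gt0 k_lt0.
have kapC : kappa%:C != 0 by rewrite (inj_eq (@complexI R)).
have Treal u : u - q != 0 -> T (a + k / (u - q))%:C = kappa%:C * u%:C.
  move=> uq; rewrite -TM; last by rewrite (inj_eq (@complexI R)) -subr_eq0.
  by rewrite rmorphD fmorph_div rmorphB.
split.
  rewrite ppE pmE !Treal // rmorphN rmorph1 mulrN mulr1 invrN mulrN opprK.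
  by rewrite mulrAC divff // mul1r.
have [u u0 ImE] := Imp.
have Tp : T p = (kappa * t)%:C * (cos gamma +i* s).
  by rewrite pE TM ?tooth_neq // rmorphM mulrA.
have kt0 : 0 < kappa * t := mulr_gt0 kap t0.
have [A1 A2] := Arg_polar g_itv kt0.
have sgnE : (0 < Im p) = (0 < s).
  by rewrite ImE pmulr_lgt0 // pmulr_rgt0 // oppr_gt0.
rewrite sgnE Tp; case: sE => ->; first by rewrite sg0 A1.
by rewrite oppr_gt0 ltNge (ltW sg0) /= A2 opprK.
Qed.
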